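(* Let $f:\langle A,R\rangle\to\langle D,W\rangle$ and $g:\langle B,S\rangle\to\langle D,W\rangle$ be morphisms in $\mathsf{EndoRel}$ with common codomain. Let $P=\{\langle a,b\rangle\in A\times B : f(a)=g(b)\}$, and define the relation $T$ on $P$ by $\langle a,b\rangle\, T\,\langle a',b'\rangle$ iff $a\,R\,a'$ and $b\,S\,b'$. Then $\langle P,T\rangle$, together with the projections $\pi_A:P\to A$ and $\pi_B:P\to B$, is a pullback of $f$ and $g$ in $\mathsf{EndoRel}$.
   Context: $\mathsf{EndoRel}$ is the category whose objects are pairs $\langle A,R\rangle$ with $A$ a set and $R\subseteq A\times A$ an arbitrary binary relation on $A$, and whose morphisms $f:\langle A,R\rangle\to\langle B,S\rangle$ are the functions $f:A\to B$ such that $\langle a,a'\rangle\in R$ implies $\langle f(a),f(a')\rangle\in S$ for all $a,a'\in A$. *)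

(* Defs.v *)
From Stdlib Require Import Relation_Definitions.
Set Implicit Arguments.
Unset Strict Implicit.
Unset Printing Implicit Defensive.

Record Category := MkCategory {
  obj :> Type;
  hom : obj -> obj -> Type;
  idm : forall X, hom X X;
  comp : forall X Y Z, hom Y Z -> hom X Y -> hom X Z;
  comp_idl : forall X Y (f : hom X Y), comp (idm Y) f = f;
  comp_idr : forall X Y (f : hom X Y), comp f (idm X) = f;
  comp_assoc : forall X Y Z V (h : hom Z V) (g : hom Y Z) (f : hom X Y),
    comp h (comp g f) = comp (comp h g) f }.

Arguments hom {c} X Y.
Arguments idm {c} X.
Arguments comp {c X Y Z} g f.

Definition is_pullback (C : Category) (X Y Z P : C)
    (f : hom X Z) (g : hom Y Z) (p : hom P X) (q : hom P Y) : Prop :=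
  comp f p = comp g q /\
  forall (Q : C) (h : hom Q X) (k : hom Q Y),
    comp f h = comp g k ->
    exists! u : hom Q P, comp p u = h /\ comp q u = k.

(* Sets are rendered as arbitrary types, possibly empty. *)
Record endorel := MkEndoRel { carrier : Type; erel : relation carrier }.

(* Equality of morphisms is Leibniz equality; under functional extensionality
   and proof irrelevance it is pointwise equality of the functions. *)
Record endorel_hom (X Y : endorel) := MkEndoRelHom {
  efun :> carrier X -> carrier Y;
  efun_rel : forall a a', erel a a' -> erel (efun a) (efun a') }.

Definition endorel_id (X : endorel) : endorel_hom X X :=
  MkEndoRelHom (efun := fun a => a) (fun a a' r => r).

Definition endorel_comp (X Y Z : endorel)
    (g : endorel_hom Y Z) (f : endorel_hom X Y) : endorel_hom X Z :=
  MkEndoRelHom (efun := fun a => g (f a))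
    (fun a a' r => efun_rel g (efun_rel f r)).

Lemma endorel_comp_idl (X Y : endorel) (f : endorel_hom X Y) :
  endorel_comp (endorel_id Y) f = f.
Proof. destruct f; reflexivity. Qed.

Lemma endorel_comp_idr (X Y : endorel) (f : endorel_hom X Y) :
  endorel_comp f (endorel_id X) = f.
Proof. destruct f; reflexivity. Qed.

Lemma endorel_comp_assoc (X Y Z V : endorel) (h : endorel_hom Z V)
    (g : endorel_hom Y Z) (f : endorel_hom X Y) :
  endorel_comp h (endorel_comp g f) = endorel_comp (endorel_comp h g) f.
Proof. reflexivity. Qed.

Definition EndoRel : Category :=
  MkCategory endorel_comp_idl endorel_comp_idr endorel_comp_assoc.

(* The set P of pairs <a, b> with f a = g b. *)
Definition fprod (A B D : Type) (f : A -> D) (g : B -> D) : Type :=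
  {x : A * B | f (fst x) = g (snd x)}.

Definition fprod_fst (A B D : Type) (f : A -> D) (g : B -> D)
    (x : fprod f g) : A := fst (proj1_sig x).

Definition fprod_snd (A B D : Type) (f : A -> D) (g : B -> D)
    (x : fprod f g) : B := snd (proj1_sig x).

Definition fprod_rel (A B D : Type) (R : relation A) (S : relation B)
    (f : A -> D) (g : B -> D) : relation (fprod f g) :=
  fun x y => R (fprod_fst x) (fprod_fst y) /\ S (fprod_snd x) (fprod_snd y).

Definition fprod_endorel (A B D : Type) (R : relation A) (S : relation B)
    (f : A -> D) (g : B -> D) : EndoRel :=
  MkEndoRel (fprod_rel R S (f := f) (g := g)).

Definition proj_fst (A B D : Type) (R : relation A) (S : relation B)
    (f : A -> D) (g : B -> D) :
    @hom EndoRel (fprod_endorel R S f g) (MkEndoRel R) :=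
  MkEndoRelHom (X := fprod_endorel R S f g) (Y := MkEndoRel R)
    (efun := @fprod_fst A B D f g) (fun x y r => proj1 r).

Definition proj_snd (A B D : Type) (R : relation A) (S : relation B)
    (f : A -> D) (g : B -> D) :
    @hom EndoRel (fprod_endorel R S f g) (MkEndoRel S) :=
  MkEndoRelHom (X := fprod_endorel R S f g) (Y := MkEndoRel S)
    (efun := @fprod_snd A B D f g) (fun x y r => proj2 r).

(* Main.v *)
Require Import Defs.
From Stdlib Require Import Relation_Definitions.
From Stdlib Require Import FunctionalExtensionality ProofIrrelevance.

(** A map into $P$ preserves relations exactly when both its components do, since $T$ is defined
    componentwise. Hence the mediating function $x \mapsto (h(x), k(x))$ of the pullback of sets is
    already a morphism, and it is unique because it is unique as a function. Morphisms and points of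
    $P$ also carry proofs; [endorel_hom_ext] and [fprod_ext] discard these by proof irrelevance. *)

Lemma endorel_hom_ext (X Y : endorel) (u v : endorel_hom X Y) :
  (forall x, u x = v x) -> u = v.
Proof.
  destruct u as [u Hu], v as [v Hv]; simpl; intros E.
  apply functional_extensionality in E; subst v.
  f_equal; apply proof_irrelevance.
Qed.

Lemma fprod_ext (A B D : Type) (f : A -> D) (g : B -> D) (x y : fprod f g) :
  fprod_fst x = fprod_fst y -> fprod_snd x = fprod_snd y -> x = y.
Proof.
  destruct x as [[a b] p], y as [[a' b'] p'].
  unfold fprod_fst, fprod_snd; simpl; intros -> ->.
  f_equal; apply proof_irrelevance.
Qed.

Definition fprod_pair (A B D Q : Type) (f : A -> D) (g : B -> D)
    (h : Q -> A) (k : Q -> B) (E : forall x, f (h x) = g (k x)) (x : Q) :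
    fprod f g :=
  exist (fun y : A * B => f (fst y) = g (snd y)) (h x, k x) (E x).

Theorem mainTheorem5 (A B D : Type)
    (R : relation A) (S : relation B) (W : relation D)
    (f : @hom EndoRel (MkEndoRel R) (MkEndoRel W))
    (g : @hom EndoRel (MkEndoRel S) (MkEndoRel W)) :
  @is_pullback EndoRel (MkEndoRel R) (MkEndoRel S) (MkEndoRel W)
    (fprod_endorel R S (efun f) (efun g))
    f g (proj_fst R S (efun f) (efun g)) (proj_snd R S (efun f) (efun g)).
Proof.
  split.
  - apply endorel_hom_ext; intros x; exact (proj2_sig x).
  - intros Q h k E.
    assert (E' : forall x, efun f (efun h x) = efun g (efun k x)).
    { intros x; exact (f_equal (fun m : endorel_hom _ _ => m x) E). }
    unshelve eexists (MkEndoRelHom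
      (X := Q) (Y := fprod_endorel R S (efun f) (efun g))
      (efun := fprod_pair _ _ _ _ _ _ _ _ E') _).
    (* $T$ asks for nothing beyond its two components, which [h] and [k] preserve. *)
    + intros a a' r; exact (conj (efun_rel h r) (efun_rel k r)).
    + split.
      * split; apply endorel_hom_ext; reflexivity.
      (* Now [h] and [k] are the composites of the projections with [v], so both coordinates agree
         by computation. *)
      * intros v [Hh Hk]; subst h k.
        apply endorel_hom_ext; intros x; apply fprod_ext; reflexivity.
Qed.
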